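(* Let $A$ be a nonzero commutative ring and let $M$ be a cancellative commutative monoid. Then the monoid algebra $A[M]$ is unit-additive if and only if at least one of the following holds: (1) $\operatorname{char}(A)=0$, $A$ is unit-additive, and $M$ is torsion-free and positive; or (2) $\operatorname{char}(A)$ is a positive power of a prime number $p$, $A$ is unit-additive, and $M/M_p$ is torsion-free and positive.
   Context: All rings are commutative and unital. A ring $R$ is unit-additive if whenever $u,v$ are units of $R$, $u+v$ is either a unit of $R$ or a nilpotent element. Monoids are written multiplicatively as $(M,\cdot,1)$. $M$ is cancellative if $xz=yz$ implies $x=y$. An element $x\in M$ is a unit if $xy=1$ for some $y\in M$; $M$ is positive if $1$ is its only unit. An element $x\in M$ is a torsion element if $x^n=1$ for some integer $n\ge 1$, and the smallest such $n$ is its order; $M$ is torsion-free if $1$ is its only torsion element. For a prime $p$, $M_p$ is the set of torsion elements of $M$ whose order is $p^n$ for some $n\ge 0$; it is a group under the operation of $M$. $M/M_p$ is the quotient monoid whose elements are the cosets $mM_p$ ($m\in M$), with multiplication $(mM_p)(nM_p)=mnM_p$. $A[M]$ is the usual monoid algebra: the free $A$-module on the basis $M$ with multiplication determined by $(ax)(by)=(ab)(xy)$ for $a,b\in A$, $x,y\in M$. *)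

(* Defs.v *)
From HB Require Import structures.
From mathcomp Require Import all_boot all_order all_algebra.
From mathcomp Require Import finmap monalg.
From mathcomp Require Import generic_quotient boolp.

Set Implicit Arguments.
Unset Strict Implicit.
Unset Printing Implicit Defensive.

Import GRing.Theory.

Local Open Scope ring_scope.

(* [GRing.unit] is not used: it needs a [unitRingType], whereas here the ring
   carries no chosen inverse. *)
Definition ring_unit (R : comPzRingType) (u : R) : Prop :=
  exists v : R, u * v = 1.

Definition ring_nilpotent (R : comPzRingType) (x : R) : Prop :=
  exists n : nat, x ^+ n = 0.

Definition unit_additive (R : comPzRingType) : Prop :=
  forall u v : R, ring_unit u -> ring_unit v ->
    ring_unit (u + v) \/ ring_nilpotent (u + v).

(* The characteristic as a natural number; MathComp's [pchar R] is only the set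
   of primes that vanish in [R]. *)
Definition ringchar (R : pzRingType) : nat :=
  if pselect (exists n, (0 < n)%N && (n%:R == 0 :> R)) is left nP
  then ex_minn nP else 0%N.

Lemma ringcharP (R : pzRingType) (k : nat) :
  (k%:R == 0 :> R) = (ringchar R %| k)%N.
Proof.
rewrite /ringchar; case: pselect => [nP|nP]; last first.
  rewrite dvd0n; case: k => [|k]; first by rewrite !eqxx.
  by apply/negbTE/negP => k0; apply: nP; exists k.+1.
case: ex_minnP => m /andP[m_gt0 /eqP m0] m_min.
rewrite {1}(divn_eq k m) natrD natrM m0 mulr0 add0r /dvdn.
have [->|r_neq0] := eqVneq (k %% m)%N 0%N; first by rewrite !eqxx.
apply/negbTE/negP => r0.
have := m_min (k %% m)%N; rewrite lt0n r_neq0 r0 => /(_ isT).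
by rewrite leqNgt ltn_pmod.
Qed.

HB.mixin Record Monoid_isCommutative M of monoid.Monoid M := {
  mulmonC : commutative (@monoid.mul M)
}.

#[short(type="comMonoidType")]
HB.structure Definition ComMonoid := {M of Monoid_isCommutative M & monoid.Monoid M}.

Section Monoids.
Local Open Scope group_scope.
Context (M : monoidType).
Implicit Types (x : M) (n p : nat).

(* [cancellative] and [monoid_unit] are one-sided: only meant for commutative
   [M]. *)
Definition cancellative : Prop :=
  forall x y z : M, x * z = y * z -> x = y.

Definition monoid_unit x : Prop := exists y : M, x * y = 1.

Definition positive : Prop := forall x, monoid_unit x -> x = 1.

Definition torsion x : Prop := exists n, (0 < n)%N /\ x ^+ n = 1.

Definition torsion_free : Prop := forall x, torsion x -> x = 1.

Definition has_order x n : Prop :=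
  [/\ (0 < n)%N, x ^+ n = 1 &
      forall k, (0 < k)%N -> x ^+ k = 1 -> (n <= k)%N].

Definition tors_part p x : Prop := exists n, has_order x (p ^ n)%N.

Definition tors_coset p x : M -> Prop :=
  fun y => exists2 t, tors_part p t & y = x * t.

End Monoids.

Arguments cancellative : clear implicits.
Arguments positive : clear implicits.
Arguments torsion_free : clear implicits.

Section TorsionQuotient.
Local Open Scope quotient_scope.
Local Open Scope group_scope.
Context (M : comMonoidType).
Implicit Types (x y z t : M) (n p : nat).

Lemma tors_partP p x : prime p ->
  tors_part p x <-> exists n, x ^+ (p ^ n)%N = 1.
Proof.
move=> p_pr; split=> [[n []]|[n xpn1]]; first by exists n.
have ex_ord : exists k, (0 < k)%N && (x ^+ k == 1).
  by exists (p ^ n)%N; rewrite expn_gt0 prime_gt0 //= xpn1.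
have [m /andP[m_gt0 /eqP xm1] m_min] := ex_minnP ex_ord.
have xMm k : x ^+ (k * m)%N = 1 by rewrite mulnC expgnA xm1 expg1n.
have : (m %| p ^ n)%N.
  have [r0|] := posnP (p ^ n %% m)%N; first by rewrite /dvdn r0.
  move=> r_gt0; have := m_min (p ^ n %% m)%N; rewrite r_gt0 /=.
  move: xpn1; rewrite {1}(divn_eq (p ^ n) m) expgnDr xMm mul1g => -> /(_ _).
  by rewrite eqxx leqNgt ltn_pmod // => /(_ isT).
case/(dvdn_pfactor _ _ p_pr) => e _ mE; exists e; rewrite -mE; split=> // k k0 k1.
by apply: m_min; rewrite k0 k1 eqxx.
Qed.

Lemma tors_part1 p : tors_part p (1 : M).
Proof. by exists 0%N; split=> //; rewrite expn0 expg1n. Qed.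

Lemma tors_partM p x y : prime p ->
  tors_part p x -> tors_part p y -> tors_part p (x * y).
Proof.
move=> p_pr /(tors_partP _ p_pr)[a xa] /(tors_partP _ p_pr)[b yb].
apply/(tors_partP _ p_pr); exists (a + b)%N.
rewrite expgMn; last exact: mulmonC.
by rewrite expnD expgnA xa expg1n mul1g mulnC expgnA yb expg1n.
Qed.

Lemma tors_coset_eqP p x y : prime p ->
  tors_coset p x = tors_coset p y -> exists2 t, tors_part p t & x = y * t.
Proof.
move=> p_pr eq_xy; suff: tors_coset p y x by [].
by rewrite -eq_xy; exists 1; rewrite ?mulg1 //; apply: tors_part1.
Qed.

Lemma tors_cosetM p x x' y y' : prime p ->
  tors_coset p x = tors_coset p x' -> tors_coset p y = tors_coset p y' ->
  tors_coset p (x * y) = tors_coset p (x' * y').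
Proof.
move=> p_pr.
suff sub u u' v v' : tors_coset p u = tors_coset p u' ->
    tors_coset p v = tors_coset p v' ->
    forall z, tors_coset p (u * v) z -> tors_coset p (u' * v') z.
  by move=> ex ey; apply/funext => z; apply/propext; split; apply: sub.
move=> /(tors_coset_eqP p_pr)[t tp ->] /(tors_coset_eqP p_pr)[s sp ->] _ [r rp ->].
exists (t * s * r); first by do 2!apply: tors_partM => //.
by rewrite !mulgA -(mulgA u' t) (mulmonC t) !mulgA.
Qed.

Definition tors_rel p (p_pr : prime p) : rel M :=
  fun x y => `[< tors_coset p x = tors_coset p y >].

Lemma tors_rel_equiv p (p_pr : prime p) : equiv_class_of (tors_rel p_pr).
Proof.
split=> [x|x y|y x z].
- exact/asboolP.
- by apply/asboolP/asboolP.
- by move=> /asboolP + /asboolP; rewrite /tors_rel => -> ->; apply/asboolP.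
Qed.

Canonical tors_equiv p (p_pr : prime p) : equiv_rel M :=
  EquivRelPack (tors_rel_equiv p_pr).

(* M / M_p, where \pi x is the coset x M_p; for non-prime [p] the cosets need
   not multiply. *)
Definition quot_tors p (p_pr : prime p) : Type := {eq_quot (tors_equiv p_pr)}.

Section Structure.
Context (p : nat) (p_pr : prime p).
Local Notation Q := (quot_tors p_pr).

HB.instance Definition _ := Choice.on Q.
HB.instance Definition _ := EqQuotient.on Q.

Lemma quot_torsP x y : \pi_Q x = \pi_Q y <-> tors_coset p x = tors_coset p y.
Proof.
split=> [/eqP|exy]; first by rewrite piE => /asboolP.
by apply/eqP; rewrite piE; apply/asboolP.
Qed.

Definition quot_mul (a b : Q) : Q := \pi_Q (repr a * repr b).
Definition quot_one : Q := \pi_Q 1.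

Lemma quot_mulE x y : quot_mul (\pi_Q x) (\pi_Q y) = \pi_Q (x * y).
Proof.
apply/quot_torsP/(tors_cosetM p_pr); apply/quot_torsP; exact: reprK.
Qed.

Lemma quot_mulA : associative quot_mul.
Proof.
elim/quotW=> x; elim/quotW=> y; elim/quotW=> z.
by rewrite (quot_mulE y z) (quot_mulE x y) (quot_mulE x) (quot_mulE _ z) mulgA.
Qed.

Lemma quot_mul1 : left_id quot_one quot_mul.
Proof. by elim/quotW=> x; rewrite (quot_mulE 1 x) mul1g. Qed.

Lemma quot_mulC : commutative quot_mul.
Proof. by elim/quotW=> x; elim/quotW=> y; rewrite (quot_mulE x y) (quot_mulE y x) mulmonC. Qed.

Lemma quot_mulr1 : right_id quot_one quot_mul.
Proof. by move=> a; rewrite quot_mulC quot_mul1. Qed.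

HB.instance Definition _ := isMonoid.Build Q quot_mulA quot_mul1 quot_mulr1.
HB.instance Definition _ := Monoid_isCommutative.Build Q quot_mulC.

Lemma quot_torsM x y : \pi_Q x * \pi_Q y = \pi_Q (x * y) :> Q.
Proof. exact: quot_mulE. Qed.

End Structure.
End TorsionQuotient.

(* [{malg A[M]}] is the free [A]-module on [M], but the library makes it a ring
   only for [M : monomType], whose only unit is 1; hence this copy, with the
   product for an arbitrary monoid. *)
Definition monoid_algebra (A : nzRingType) (M : choiceType) : predArgType :=
  {malg A[M]}.

HB.instance Definition _ (A : nzRingType) (M : choiceType) :=
  GRing.Lmodule.on (monoid_algebra A M).

Section MonoidAlgebraRing.
Context (A : nzRingType) (M : monoidType).
Local Notation AM := (monoid_algebra A M).
Implicit Types (f g h : AM) (x y : M) (a b : A).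

Definition ma_one : AM := << 1%g >>.

Definition ma_mul f g : AM :=
  \sum_(x <- msupp f) \sum_(y <- msupp g) << f@_x * g@_y *g (x * y)%g >>.

Lemma ma_mulEw (d1 d2 : {fset M}) f g :
  (msupp f `<=` d1)%fset -> (msupp g `<=` d2)%fset ->
  ma_mul f g = \sum_(x <- d1) \sum_(y <- d2) << f@_x * g@_y *g (x * y)%g >>.
Proof.
move=> le1 le2; rewrite /ma_mul (big_fset_incl _ le1) /=.
  apply: eq_bigr => x _; apply: big_fset_incl => // y _ /mcoeff_outdom ->.
  by rewrite mulr0 monalgU0.
move=> x _ /mcoeff_outdom fx0.
by rewrite big1 // => y _; rewrite fx0 mul0r monalgU0.
Qed.

Lemma ma_mulUU a b x y :
  ma_mul << a *g x >> << b *g y >> = << a * b *g (x * y)%g >>.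
Proof. by rewrite (ma_mulEw msuppU_le msuppU_le) !big_seq_fset1 !mcoeffUU. Qed.

Lemma ma_mulDl : left_distributive ma_mul +%R.
Proof.
move=> f1 f2 g; have l1 := fsubsetUl (msupp f1) (msupp f2).
have l2 := fsubsetUr (msupp f1) (msupp f2); have lg := fsubset_refl (msupp g).
rewrite (ma_mulEw l1 lg) (ma_mulEw l2 lg) (ma_mulEw (msuppD_le f1 f2) lg).
rewrite -big_split /=; apply: eq_bigr => x _.
rewrite -big_split /=; apply: eq_bigr => y _.
by rewrite mcoeffD mulrDl monalgUD.
Qed.

Lemma ma_mulDr : right_distributive ma_mul +%R.
Proof.
move=> f g1 g2; have l1 := fsubsetUl (msupp g1) (msupp g2).
have l2 := fsubsetUr (msupp g1) (msupp g2); have lf := fsubset_refl (msupp f).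
rewrite (ma_mulEw lf l1) (ma_mulEw lf l2) (ma_mulEw lf (msuppD_le g1 g2)).
rewrite -big_split /=; apply: eq_bigr => x _.
rewrite -big_split /=; apply: eq_bigr => y _.
by rewrite mcoeffD mulrDr monalgUD.
Qed.

Lemma ma_mul0l : left_zero 0 ma_mul.
Proof. by move=> g; rewrite /ma_mul msupp0 big_seq_fset0. Qed.

Lemma ma_mul0r : right_zero 0 ma_mul.
Proof.
by move=> f; rewrite /ma_mul msupp0 big1 // => x _; rewrite big_seq_fset0.
Qed.

Lemma ma_mul_suml (I : Type) (r : seq I) (F : I -> AM) g :
  ma_mul (\sum_(i <- r) F i) g = \sum_(i <- r) ma_mul (F i) g.
Proof.
by apply: (big_morph (ma_mul^~ g) (fun _ _ => ma_mulDl _ _ _) (ma_mul0l g)).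
Qed.

Lemma ma_mul_sumr (I : Type) (r : seq I) (F : I -> AM) f :
  ma_mul f (\sum_(i <- r) F i) = \sum_(i <- r) ma_mul f (F i).
Proof.
by apply: (big_morph (ma_mul f) (fun _ _ => ma_mulDr _ _ _) (ma_mul0r f)).
Qed.

Lemma ma_mulA : associative ma_mul.
Proof.
move=> f g h; rewrite [f]monalgE (ma_mul_suml _ _ (ma_mul g h)).
rewrite (ma_mul_suml _ _ g) (ma_mul_suml _ _ h); apply: eq_bigr => x _.
rewrite [g]monalgE (ma_mul_suml _ _ h) (ma_mul_sumr _ _ << f@_x *g x >>).
rewrite (ma_mul_sumr _ _ << f@_x *g x >>) (ma_mul_suml _ _ h).
apply: eq_bigr => y _; rewrite [h]monalgE (ma_mul_sumr _ _ << g@_y *g y >>).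
rewrite (ma_mul_sumr _ _ << f@_x *g x >>) (ma_mul_sumr _ _ (ma_mul _ _)).
apply: eq_bigr => z _.
by rewrite (ma_mulUU (g@_y)) (ma_mulUU (f@_x)) !ma_mulUU mulrA mulgA.
Qed.

Lemma ma_mul1l : left_id ma_one ma_mul.
Proof.
move=> f; rewrite [f]monalgE ma_mul_sumr; apply: eq_bigr => x _.
by rewrite ma_mulUU mul1r mul1g.
Qed.

Lemma ma_mul1r : right_id ma_one ma_mul.
Proof.
move=> f; rewrite [f]monalgE ma_mul_suml; apply: eq_bigr => x _.
by rewrite ma_mulUU mulr1 mulg1.
Qed.

Lemma ma_one_neq0 : ma_one != 0.
Proof. by rewrite monalgU_eq0 oner_eq0. Qed.

HB.instance Definition _ := GRing.Zmodule_isNzRing.Build AM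
  ma_mulA ma_mul1l ma_mul1r ma_mulDl ma_mulDr ma_one_neq0.

Lemma ma_scaleE a f : a *: f = (<< a *g 1%g >> : AM) * f.
Proof.
rewrite [RHS](ma_mulEw msuppU_le (fsubset_refl (msupp f))) big_seq_fset1.
by rewrite [LHS]malgZ_def; apply: eq_bigr => x _; rewrite mcoeffUU mul1g.
Qed.

Lemma ma_scaleAl a f g : a *: (f * g) = a *: f * g.
Proof. by rewrite !ma_scaleE mulrA. Qed.

HB.instance Definition _ := GRing.Lmodule_isLalgebra.Build A AM ma_scaleAl.

End MonoidAlgebraRing.

Section MonoidAlgebraComRing.
Context (A : comNzRingType) (M : comMonoidType).
Local Notation AM := (monoid_algebra A M).

Lemma ma_mulC : @commutative AM AM *%R.
Proof.
move=> f g; rewrite [LHS]/(ma_mul f g) [RHS]/(ma_mul g f) /ma_mul exchange_big.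
apply: eq_bigr => y _; apply: eq_bigr => x _.
by rewrite mulrC [(x * y)%g]mulmonC.
Qed.

HB.instance Definition _ := GRing.PzRing_hasCommutativeMul.Build AM ma_mulC.
HB.instance Definition _ := GRing.Lalgebra_isComAlgebra.Build A AM.

Lemma monoid_algebraMU (a b : A) (x y : M) :
  (<< a *g x >> : AM) * << b *g y >> = << a * b *g (x * y)%g >>.
Proof. exact: ma_mulUU. Qed.

End MonoidAlgebraComRing.

(* Main.v *)
(* Let [f * g = 1] in [R[D]], where [D] is linearly ordered on the supports of
   [f] and [g] and has no unit besides [1].  Unless [f] is supported at [1], the
   order can be chosen so that the largest element [d] of the support of [f] is
   not [1].  Then [d * e <> 1] for every [e], so reading off the coefficients
   of [f * g] at [d * e], from the largest [e] downwards, shows that ever higher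
   powers of [f_d] kill [g_e]; for [e = 1], where [f_1 * g_1 = 1], this makes
   [f_d] nilpotent.  Removing [f_d] and repeating, all coefficients of [f]
   outside [1] are nilpotent.

   A cancellative [M] whose units are torsion is graded by such a [D], the
   quotient of [M] that identifies [x] and [y] when [x^n = y^n] for some
   [n > 0]; its component of degree [1] is spanned by the torsion elements.
   Hence a unit of [A[M]] is, up to a nilpotent, a combination of torsion
   elements, and in both cases of the theorem each torsion element is [1] up to
   a nilpotent, so that [A[M]] inherits unit-additivity from [A].

   Conversely, if [A[M]] is unit-additive and [x] is a unit of [M], then [x - 1]
   has augmentation [0], so it is nilpotent.  This forces [x] to be torsion, and
   even [x = 1] when its order is invertible in [A]. *)
Require Import Defs.
From HB Require Import structures.
From mathcomp Require Import all_boot all_order all_algebra.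
From mathcomp Require Import finmap monalg.
From mathcomp Require Import generic_quotient boolp.

Set Implicit Arguments.
Unset Strict Implicit.
Unset Printing Implicit Defensive.

Import GRing.Theory.

Local Open Scope ring_scope.

(** * Units, nilpotents and integers in a commutative ring *)

Section UnitsNilpotents.
Context (R : comPzRingType).
Implicit Types x y u v : R.

Lemma ring_nilpotent0 : ring_nilpotent (0 : R).
Proof. by exists 1%N; rewrite expr1. Qed.

Lemma ring_nilpotentD x y :
  ring_nilpotent x -> ring_nilpotent y -> ring_nilpotent (x + y).
Proof.
move=> [m xm0] [n yn0]; exists (m + n)%N; rewrite exprDn big1 // => i _.
have [le_ni|/ltnW le_in] := leqP n i.
  by rewrite -(subnKC le_ni) (exprD y) yn0 mul0r mulr0 mul0rn.
by rewrite -addnBA // (exprD x) xm0 !mul0r mul0rn.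
Qed.

Lemma ring_nilpotentM x y : ring_nilpotent x -> ring_nilpotent (x * y).
Proof. by move=> [n xn0]; exists n; rewrite exprMn xn0 mul0r. Qed.

Lemma ring_nilpotentN x : ring_nilpotent x -> ring_nilpotent (- x).
Proof. by move=> nil_x; rewrite -mulrN1; apply: ring_nilpotentM. Qed.

Lemma ring_nilpotent_sum (I : eqType) (r : seq I) (P : pred I) (F : I -> R) :
  (forall i, i \in r -> P i -> ring_nilpotent (F i)) ->
  ring_nilpotent (\sum_(i <- r | P i) F i).
Proof.
move=> nilF; rewrite big_seq_cond; apply: (big_ind (@ring_nilpotent R)).
- exact: ring_nilpotent0.
- exact: ring_nilpotentD.
- by move=> i /andP[]; apply: nilF.
Qed.

Lemma ring_nilpotent_exp x n : ring_nilpotent (x ^+ n) -> ring_nilpotent x.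
Proof. by move=> [m xnm0]; exists (n * m)%N; rewrite exprM. Qed.

Lemma ring_nilpotent_subX x n :
  ring_nilpotent (x - 1) -> ring_nilpotent (x ^+ n - 1).
Proof. by rewrite subrX1; apply: ring_nilpotentM. Qed.

Lemma ring_unitM u v : ring_unit (u * v) <-> ring_unit u /\ ring_unit v.
Proof.
split=> [[w uvw]|[[u' uu'] [v' vv']]].
  split; first by exists (v * w); rewrite mulrA.
  by exists (u * w); rewrite mulrCA mulrA.
by exists (u' * v'); rewrite mulrACA uu' vv' mulr1.
Qed.

Lemma ring_unit1 : ring_unit (1 : R).
Proof. by exists 1; rewrite mulr1. Qed.

Lemma ring_unitD_nil u x : ring_unit u -> ring_nilpotent x -> ring_unit (u + x).
Proof.
move=> [v uv1] nil_x; suff [w w1]: ring_unit (1 + v * x).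
  by exists (v * w); rewrite mulrA mulrDl uv1 (mulrC x).
have [n yn0] : ring_nilpotent (- (v * x)).
  by apply: ring_nilpotentN; rewrite mulrC; apply: ring_nilpotentM.
exists (\sum_(i < n) (- (v * x)) ^+ i).
by rewrite -[1 + _]opprK opprD addrC mulNr -subrX1 yn0 sub0r opprK.
Qed.

(** Induction on [k]: the successor of a unit is a sum of two units, and it is not nilpotent. *)
Lemma unit_additive_natr n : unit_additive R ->
  (forall k, (0 < k <= n)%N -> ~ ring_nilpotent (k%:R : R)) ->
  forall k, (0 < k <= n)%N -> ring_unit (k%:R : R).
Proof.
move=> uaR nnil; elim=> // -[|k] IHk lekn; first exact: ring_unit1.
have unit_k : ring_unit (k.+1%:R : R) by apply: IHk; apply: ltnW.
by have := uaR _ _ unit_k ring_unit1; rewrite natr1 => -[//|/(nnil k.+2)[]].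
Qed.

End UnitsNilpotents.

Lemma ring_unit_neq0 (R : comNzRingType) (u : R) : ring_unit u -> u <> 0.
Proof.
by move=> [v uv1] u0; move/eqP: uv1; rewrite u0 mul0r eq_sym oner_eq0.
Qed.

Lemma ring_unit_nonnil (R : comNzRingType) (u : R) :
  ring_unit u -> ~ ring_nilpotent u.
Proof.
move=> [v uv1] [n un0]; have := expr1n R n.
by rewrite -uv1 exprMn un0 mul0r => /eqP; rewrite eq_sym uv1 oner_eq0.
Qed.

Lemma ring_unit_rmorph (R S : comPzRingType) (F : {rmorphism R -> S}) u :
  ring_unit u -> ring_unit (F u).
Proof. by move=> [v uv1]; exists (F v); rewrite -rmorphM uv1 rmorph1. Qed.

Lemma ring_nilpotent_rmorph (R S : comPzRingType) (F : {rmorphism R -> S}) x :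
  ring_nilpotent x -> ring_nilpotent (F x).
Proof. by move=> [n xn0]; exists n; rewrite -rmorphXn xn0 rmorph0. Qed.

Lemma coprime_ring_unit (R : comNzRingType) d :
  coprime (ringchar R) d -> ring_unit (d%:R : R).
Proof.
case: (posnP d) => [->|d_gt0].
  rewrite /coprime gcdn0 => /eqP char1.
  by have := ringcharP R 1; rewrite char1 oner_eq0.
rewrite coprime_sym => /(coprimeP _ d_gt0)[[a b] /=].
move=> /(congr1 (fun n => n%:R : R)).
have char0 : (ringchar R)%:R = 0 :> R by apply/eqP; rewrite ringcharP.
have [le_ba|lt_ab] := leqP (b * ringchar R) (a * d).
  rewrite natrB // !natrM char0 mulr0 subr0 => ad1.
  by exists a%:R; rewrite mulrC.
(* The Bezout difference is truncated: here it would be 0 instead of 1. *)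
by rewrite (eqP (ltnW lt_ab)) => /eqP; rewrite eq_sym oner_eq0.
Qed.

(** Let [k] be the least positive integer that is nilpotent in [R]. All smaller ones are units, so
    [k] is prime, because a product of units is not nilpotent. A power of [k] vanishes in [R], so
    the characteristic divides it. *)
Lemma unit_additive_char (R : comNzRingType) : unit_additive R ->
  ringchar R = 0%N \/
  exists p, prime p /\ exists2 e, (0 < e)%N & ringchar R = (p ^ e)%N.
Proof.
move=> uaR; have [|char_gt0] := posnP (ringchar R); [by left | right].
have char0 : (ringchar R)%:R = 0 :> R by apply/eqP; rewrite ringcharP.
have [k /andP[k_gt0 /asboolP nil_k] k_min] :
    {k | (0 < k)%N && `[< ring_nilpotent (k%:R : R) >]
       & forall j, (0 < j)%N && `[< ring_nilpotent (j%:R : R) >] -> (k <= j)%N}.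
  have exk : exists k, (0 < k)%N && `[< ring_nilpotent (k%:R : R) >].
    by exists (ringchar R); rewrite char_gt0 /=; apply/asboolP; exists 1%N.
  by case: (ex_minnP exk) => k; exists k.
have unit_lt j : (0 < j < k)%N -> ring_unit (j%:R : R).
  move=> /andP[j_gt0 lt_jk].
  have: (0 < j <= k.-1)%N by rewrite j_gt0 -ltnS prednK.
  apply: unit_additive_natr => // i /andP[i_gt0].
  rewrite -ltnS prednK // ltnNge => /negP le_ki /asboolP nil_i.
  by apply/le_ki/k_min/andP.
have k_gt1 : (1 < k)%N.
  case: k k_gt0 nil_k {k_min unit_lt} => [|[|//]] // _.
  by move/ring_unit_nonnil: (ring_unit1 R).
have k_pr : prime k.
  apply/primeP; split=> // d dvd_dk; apply/norP => -[d_neq1 d_neqk].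
  have d_gt0 := dvdn_gt0 k_gt0 dvd_dk.
  case/dvdnP: dvd_dk (dvd_dk) => c kE dvd_dk.
  have c_gt0 : (0 < c)%N by move: k_gt0; rewrite kE muln_gt0 => /andP[].
  have: ring_unit (k%:R : R); last by move/ring_unit_nonnil.
  rewrite kE natrM; apply/ring_unitM; split; apply: unit_lt.
    by rewrite c_gt0 kE ltn_Pmulr // ltn_neqAle eq_sym d_neq1.
  by rewrite d_gt0 ltn_neqAle d_neqk dvdn_leq.
exists k; split=> //; case: nil_k => n kn0.
have /(dvdn_pfactor _ _ k_pr)[e _ charE] : (ringchar R %| k ^ n)%N.
  by rewrite -ringcharP natrX kn0.
exists e => //; case: e charE => // charE.
by have := ringcharP R 1; rewrite charE oner_eq0.
Qed.

(** * Extending partial orders on a commutative monoid *)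

Definition power_cancellative (M : monoidType) : Prop :=
  forall (x y : M) n, (0 < n)%N -> (x ^+ n = y ^+ n)%g -> x = y.

Arguments power_cancellative : clear implicits.

Section MonoidOrders.
Local Open Scope group_scope.
Context (M : comMonoidType).
Implicit Types (x y z a b : M) (le : M -> M -> Prop) (n k : nat).

Lemma expgM_com x y n : (x * y) ^+ n = x ^+ n * y ^+ n.
Proof. by apply: expgMn; apply: mulmonC. Qed.

Lemma mulmonAC x y z : x * y * z = x * z * y.
Proof. by rewrite -mulgA (mulmonC y) mulgA. Qed.

Lemma mulmonACA x y z t : x * y * (z * t) = x * z * (y * t).
Proof. by rewrite !mulgA (mulmonAC x y). Qed.

(** The order may be partial, so that equality can serve as the starting point. The fields
    [mord_can] and [mord_root] carry the proof of antisymmetry in [monoid_order_extend]. *)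
Record monoid_order le : Prop := MonoidOrder {
  mord_refl : forall x, le x x;
  mord_anti : forall x y, le x y -> le y x -> x = y;
  mord_trans : forall y x z, le x y -> le y z -> le x z;
  mord_mul : forall z x y, le x y -> le (x * z) (y * z);
  mord_can : forall z x y, le (x * z) (y * z) -> le x y;
  mord_root : forall x y n, (0 < n)%N -> le (x ^+ n) (y ^+ n) -> le x y }.

Lemma monoid_order_eq :
  cancellative M -> power_cancellative M -> monoid_order (@eq M).
Proof.
move=> canM powM; by split=> // [y x z ->|z x y ->|z x y /canM].
Qed.

Section Theory.
Context le (leM : monoid_order le).

Lemma mord_mul2 x y z t : le x y -> le z t -> le (x * z) (y * t).
Proof.
move=> lexy lezt; apply: (mord_trans leM (y := y * z)).
  exact: (mord_mul leM).
by rewrite !(mulmonC y); apply: (mord_mul leM).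
Qed.

Lemma mord_exp x y n : le x y -> le (x ^+ n) (y ^+ n).
Proof.
move=> lexy; elim: n => [|n IHn]; first by rewrite !expg0; apply: mord_refl.
by rewrite !expgS; apply: mord_mul2.
Qed.

(* The smallest order containing [le] and [a <= b] that is closed under roots
   and cancellation. *)
Definition extend_order a b x y : Prop :=
  exists n k, (0 < n)%N /\ le (x ^+ n * b ^+ k) (y ^+ n * a ^+ k).

Lemma extend_order_sub a b x y : le x y -> extend_order a b x y.
Proof. by move=> lexy; exists 1%N, 0%N; rewrite !expg1 !expg0 !mulg1. Qed.

Lemma extend_orderP a b : extend_order a b a b.
Proof.
by exists 1%N, 1%N; rewrite !expg1 mulmonC; split=> //; apply: mord_refl.
Qed.

(** Antisymmetry is the point. Raising the two inequalities to a common exponent, multiplying them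
    and cancelling the powers of [x] and [y] leaves [b ^+ j] below [a ^+ j]. Taking roots excludes
    [j > 0]; for [j = 0] only powers of [x] and [y] were compared. *)
Lemma monoid_order_extend a b : ~ le b a -> monoid_order (extend_order a b).
Proof.
move=> nle_ba; have raise x y n k m : le (x ^+ n * b ^+ k) (y ^+ n * a ^+ k) ->
    le (x ^+ (n * m) * b ^+ (k * m)) (y ^+ (n * m) * a ^+ (k * m)).
  by move=> /(mord_exp m); rewrite !expgM_com -!expgnA.
split=> [x|x y|y x z|z x y|z x y|x y m m_gt0].
- exact: (extend_order_sub _ _ (mord_refl leM x)).
- move=> [n [k [n_gt0 /raise lexy]]] [m [l [m_gt0 /raise leyx]]].
  have := mord_mul2 (lexy m) (leyx n); rewrite (mulnC m n).
  rewrite (mulmonACA (x ^+ _)) (mulmonACA (y ^+ _)) -!expgnDr.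
  rewrite (mulmonC (y ^+ _) (x ^+ _)) !(mulmonC (x ^+ _ * _)).
  move=> /(mord_can leM) leba.
  have [kl0|kl_gt0] := posnP (k * m + l * n); last first.
    by case: nle_ba; apply: mord_root leba.
  move/eqP: kl0.
  rewrite addn_eq0 !muln_eq0 (gtn_eqF m_gt0) (gtn_eqF n_gt0) !orbF.
  move=> /andP[/eqP k0 /eqP l0].
  have nm_gt0 : (0 < n * m)%N by rewrite muln_gt0 n_gt0.
  apply: (mord_anti leM); apply: (mord_root leM nm_gt0).
    by have := lexy m; rewrite k0 mul0n !expg0 !mulg1.
  by have := leyx n; rewrite l0 mul0n !expg0 !mulg1 mulnC.
- move=> [n [k [n_gt0 /raise lexy]]] [m [l [m_gt0 /raise leyz]]].
  exists (n * m)%N, (k * m + l * n)%N; split; first by rewrite muln_gt0 n_gt0.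
  rewrite !expgnDr.
  apply: (mord_trans leM (y := y ^+ (n * m) * a ^+ (k * m) * b ^+ (l * n))).
    by rewrite mulgA; apply: (mord_mul leM).
  rewrite (mulmonC (a ^+ (k * m))) mulgA mulmonAC; apply: (mord_mul leM).
  by rewrite (mulnC n); apply: leyz.
- move=> [n [k [n_gt0 lexy]]]; exists n, k; split=> //.
  by rewrite !expgM_com !(mulmonAC _ (z ^+ n)); apply: (mord_mul leM).
- move=> [n [k [n_gt0]]]; rewrite !expgM_com !(mulmonAC _ (z ^+ n)).
  by move=> /(mord_can leM) lexy; exists n, k.
- move=> [n [k [n_gt0]]]; rewrite -!expgnA => lexy.
  by exists (m * n)%N, k; rewrite muln_gt0 m_gt0.
Qed.

End Theory.

(** Pairs are made comparable one at a time, so induction on the list replaces Zorn's lemma. *)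
Lemma monoid_order_extend_seq le (s : seq (M * M)) : monoid_order le ->
  exists le', [/\ monoid_order le', forall x y, le x y -> le' x y &
    {in s, forall p, le' p.1 p.2 \/ le' p.2 p.1}].
Proof.
move=> leM; elim: s => [|[a b] s [le' [leM' sub_le tot]]]; first by exists le.
have [leba|/(monoid_order_extend leM') leM''] := pselect (le' b a).
  exists le'; split=> // p; rewrite inE => /predU1P[->|].
    by right.
  exact: tot.
exists (extend_order le' a b); split=> // [x y lexy|p].
  exact: (extend_order_sub _ _ (sub_le _ _ lexy)).
rewrite inE => /predU1P[->|/tot[]]; first by left; apply: extend_orderP.
  by left; apply: extend_order_sub.
by right; apply: extend_order_sub.
Qed.

(* [r] stands for a linear order on the finite set [s] that is compatible with
   products; it can be chosen with any given [d] above [1]. *)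
Lemma monoid_rank (s : seq M) (d : M) :
    cancellative M -> power_cancellative M -> d <> 1 ->
  exists r : M -> nat, (1 \in s -> d \in s -> (r 1%g < r d)%N) /\
    forall x y z t, x \in s -> y \in s -> z \in s -> t \in s ->
      x * z = y * t -> x <> y -> (r x <= r y)%N -> (r t < r z)%N.
Proof.
move=> canM powM d_neq1.
(* Putting [1] below [d] first fixes their comparison; later extensions keep it. *)
have leM0 : monoid_order (extend_order eq 1 d).
  by apply: monoid_order_extend d_neq1; apply: monoid_order_eq.
have [le [leM sub_le tot]] :=
  monoid_order_extend_seq [seq (x, y) | x <- s, y <- s] leM0.
have le_tot : {in s &, forall x y, le x y \/ le y x}.
  by move=> x y xs ys; apply: (tot (x, y)); apply: allpairs_f.
pose lt x y := [&& `[< le x y >] & x != y].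
have lt_trans : transitive lt.
  move=> y x z /andP[/asboolP lexy neq_xy] /andP[/asboolP leyz neq_yz].
  apply/andP; split; first by apply/asboolP/(mord_trans leM lexy).
  apply/eqP => eq_xz; case/eqP: neq_xy; apply: (mord_anti leM) => //.
  by rewrite eq_xz.
pose r x := count (fun y => lt y x) s.
have lt_r : {in s & s, forall x y, lt x y -> (r x < r y)%N}.
  move=> x y xs ys ltxy; rewrite -addn1.
  apply: (@leq_trans (r x + count_mem x s)).
    by rewrite leq_add2l -has_count has_pred1.
  rewrite -count_predUI (@eq_count _ (predI _ _) pred0) ?count_pred0 ?addn0 =>
    [|z /=].
    apply: sub_count => z /= /orP[ltzx|/eqP->//]; exact: lt_trans ltxy.
  by apply/negP => /andP[/andP[_ /negP neq_zx] /neq_zx].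
exists r; split.
  move=> s1 sd; apply: lt_r => //; apply/andP; split; last first.
    by rewrite eq_sym; apply/eqP.
  by apply/asboolP/sub_le/extend_orderP/monoid_order_eq.
move=> x y z t xs ys zs ts eq_xz_yt neq_xy le_r; apply: (lt_r _ _) => //.
have lexy : le x y.
  have [//|leyx] := le_tot _ _ xs ys; have := lt_r y x ys xs.
  rewrite ltnNge le_r /lt; move/asboolP: leyx => ->.
  by have /eqP/negPf := neq_xy; rewrite eq_sym => -> /(_ isT).
(* From [z <= t] would follow [y * z <= y * t = x * z], hence [y <= x] by cancellation. *)
have not_lezt : ~ le z t.
  move=> lezt; apply/neq_xy/(mord_anti leM) => //.
  apply: (mord_can leM (z := z)).
  by rewrite eq_xz_yt !(mulmonC y); apply: (mord_mul leM).
apply/andP; split; first by apply/asboolP; case: (le_tot _ _ ts zs).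
by apply/eqP => eq_tz; apply: not_lezt; rewrite eq_tz; apply: mord_refl.
Qed.

End MonoidOrders.

(** * Units of the algebra of a positive monoid with compatible orders *)

Lemma big_seq_only1 (V : nmodType) (I : eqType) (r : seq I) (i : I)
    (F : I -> V) :
    uniq r -> (i \notin r -> F i = 0) ->
    (forall j, j \in r -> j != i -> F j = 0) ->
  \sum_(j <- r) F j = F i.
Proof.
move=> uniq_r Fi0 F0; have [ri|nri] := boolP (i \in r); last first.
  rewrite Fi0 // big1_seq // => j /andP[_ rj].
  by apply: F0 => //; apply: contraNneq nri => <-.
rewrite (bigD1_seq i) //= [X in _ + X]big_seq_cond [X in _ + X]big1 ?addr0 //.
by move=> j /andP[]; apply: F0.
Qed.

Section OrderedMonoidUnits.
Context (R : comNzRingType) (D : comMonoidType).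
Local Notation RD := (monoid_algebra R D).
Implicit Types (f g : RD) (d e x y : D).

Lemma mcoeff_mul f g c : (f * g)@_c =
  \sum_(x <- msupp f) \sum_(y <- msupp g) (f@_x * g@_y) *+ ((x * y)%g == c).
Proof.
rewrite [f * g]/(ma_mul f g) /ma_mul raddf_sum; apply: eq_bigr => x _.
by rewrite raddf_sum; apply: eq_bigr => y _; rewrite /= mcoeffU.
Qed.

Lemma mcoeff_one c : (1 : RD)@_c = (1%g == c)%:R.
Proof. by rewrite [1]/(ma_one R D) /ma_one mcoeffU. Qed.

(** The factor [a] relaxes uniqueness: a second factorization of [d * e] is harmless when [a] kills
    its term. *)
Lemma mcoeff_mul_unique f g d e a :
    (forall x y, x \in msupp f -> y \in msupp g -> (x * y = d * e)%g ->
       x = d /\ y = e \/ a * g@_y = 0) ->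
  a * (f * g)@_(d * e)%g = a * (f@_d * g@_e).
Proof.
move=> uniq_de; rewrite mcoeff_mul.
have zero x y : x \in msupp f -> y \in msupp g -> (x, y) != (d, e) ->
    a * ((f@_x * g@_y) *+ ((x * y)%g == (d * e)%g)) = 0.
  move=> fx gy /eqP neq_de; have [eq_xy|] := eqP; last by rewrite mulr0.
  have [[xd ye]|ag0] := uniq_de _ _ fx gy eq_xy.
    by rewrite xd ye in neq_de.
  by rewrite mulr1n mulrCA ag0 mulr0.
rewrite mulr_sumr (big_seq_only1 (i := d)) ?fset_uniq //.
- rewrite mulr_sumr (big_seq_only1 (i := e)) ?fset_uniq ?eqxx //.
    by move/mcoeff_outdom->; rewrite !mulr0.
  move=> y gy neq_ye; have [fd|/mcoeff_outdom->] := boolP (d \in msupp f).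
    by apply: zero => //; rewrite xpair_eqE negb_and neq_ye orbT.
  by rewrite mul0r mul0rn mulr0.
- by move/mcoeff_outdom->; rewrite big1 ?mulr0 // => y _; rewrite mul0r mul0rn.
move=> x fx neq_xd; rewrite mulr_sumr big1_seq // => y /andP[_ gy].
by apply: zero => //; rewrite xpair_eqE negb_and neq_xd.
Qed.

Context (canD : cancellative D) (powD : power_cancellative D).
Context (posD : positive D).

Lemma positive_mul1 x y : (x * y = 1)%g -> x = 1%g /\ y = 1%g.
Proof.
move=> xy1; split; apply: posD; first by exists y.
by exists x; rewrite mulmonC.
Qed.

Lemma unit_mcoeff1 f g : f * g = 1 -> f@_1%g * g@_1%g = 1.
Proof.
move=> fg1; have := @mcoeff_mul_unique f g 1%g 1%g 1.
rewrite !mul1r mulg1 fg1 mcoeff_one eqxx => <- // x y _ _ /positive_mul1.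
by left.
Qed.

Lemma unit_mcoeff_top f g : f * g = 1 ->
  (exists2 d, d \in msupp f & d <> 1%g) ->
  exists d, [/\ d \in msupp f, d <> 1%g & ring_nilpotent f@_d].
Proof.
move=> fg1 [d0 fd0 d0_neq1].
pose s := 1%g :: msupp f ++ msupp g.
have [r [r1d0 r_lt]] := monoid_rank s canD powD d0_neq1.
have fs x : x \in msupp f -> x \in s by rewrite inE mem_cat => ->; rewrite orbT.
have gs x : x \in msupp g -> x \in s.
  by rewrite inE mem_cat => ->; rewrite !orbT.
have s1 : 1%g \in s by rewrite inE eqxx.
(* [d] has maximal rank in the support of [f]. Since [d0] ranks above [1], so does [d]. *)
case: (@arg_maxnP _ [` fd0]%fset predT (fun i => r (val i)) isT).
move=> [d fd] /= _ d_max.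
have d_neq1 : d <> 1%g.
  move=> d1; have := d_max [` fd0]%fset isT; rewrite d1 /=.
  by rewrite leqNgt r1d0 // fs.
exists d; split=> //.
(* Downward induction on the rank of [e]: for [k = 0] no element of [s] has so large a rank, and
   each step down costs one more factor [f@_d]. *)
have killed k : forall e, e \in s ->
    (\max_(x <- s) r x < k + r e)%N -> f@_d ^+ k * g@_e = 0.
  elim: k => [|k IHk] e es ltk.
    by move: ltk; rewrite add0n ltnNge leq_bigmax_seq.
  have := @mcoeff_mul_unique f g d e (f@_d ^+ k).
  rewrite fg1 mcoeff_one; case: eqP => [/esym/positive_mul1[//]|_].
  rewrite mulr0 exprSr -mulrA => <- // x y fx gy eq_xy.
  have [eq_xd|neq_xd] := pselect (x = d).
    left; split=> //; apply: (canD (z := d)).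
    by rewrite !(mulmonC _ d) -eq_xy eq_xd.
  (* Since [r x <= r d], the equality [x * y = d * e] forces [y] to rank above [e], where fewer
     factors suffice. *)
  right; apply: IHk; first exact: gs.
  have lt_ey : (r e < r y)%N.
    apply: (r_lt x d y e (fs x fx) (fs d fd) (gs y gy) es eq_xy neq_xd).
    exact: (d_max [` fx]%fset).
  by apply: leq_trans ltk _; rewrite addSnnS leq_add2l.
(* An exponent above all ranks is large enough at [e = 1], where the coefficient of [g] is a
   unit. *)
exists (\max_(x <- s) r x).+1.
have := unit_mcoeff1 fg1; set a := f@_1%g => ag1.
rewrite -[LHS]mulr1 -ag1 mulrCA killed ?mulr0 //.
by rewrite ltn_addr.
Qed.

Lemma unit_mcoeff_nilpotent f d :
  ring_unit f -> d <> 1%g -> ring_nilpotent f@_d.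
Proof.
move: {2}_.+1 (ltnSn #|` msupp f|) => n.
elim: n f d => // n IHn f d ltfn [g fg1] d_neq1.
have [fd|/mcoeff_outdom->] := boolP (d \in msupp f); last first.
  exact: ring_nilpotent0.
have [c [fc c_neq1 [m fcm0]]] : exists c,
     [/\ c \in msupp f, c <> 1%g & ring_nilpotent f@_c].
  by apply: (unit_mcoeff_top fg1); exists d.
(* Dropping a nilpotent term keeps a unit and shrinks the support. *)
pose f' : RD := f - << f@_c *g c >>.
have f'E x : f'@_x = f@_x *+ (x != c).
  rewrite mcoeffB mcoeffU (eq_sym x); case: eqP => [->|_].
    by rewrite subrr.
  by rewrite subr0.
have [eq_dc|/eqP neq_dc] := pselect (d = c); first by rewrite eq_dc; exists m.
have := f'E d; rewrite neq_dc mulr1n => <-; apply: IHn => //.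
  rewrite ltnS in ltfn; apply: leq_trans ltfn; apply: fproper_ltn_card.
  rewrite fproperE; apply/andP; split.
    apply/fsubsetP => x.
    by rewrite -!mcoeff_neq0 f'E; case: (x != c); rewrite // mulr0n eqxx.
  by apply/fsubsetPn; exists c; rewrite // -mcoeff_eq0 f'E eqxx.
apply: ring_unitD_nil; first by exists g.
apply: ring_nilpotentN; exists m.
suff -> : (<< f@_c *g c >> : RD) ^+ m = << f@_c ^+ m *g (c ^+ m)%g >>.
  by rewrite fcm0 monalgU0.
elim: (m) => [|k IHk]; first by rewrite !expr0 expg0.
by rewrite exprS IHk monoid_algebraMU -exprS -expgS.
Qed.

End OrderedMonoidUnits.

(** * Ring morphisms out of a monoid algebra *)

Section Lift.
Context (A S : comNzRingType) (M : comMonoidType).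
Context (iota : {rmorphism A -> S}) (chi : M -> S).
Context (chi1 : chi 1%g = 1) (chiM : forall x y, chi (x * y)%g = chi x * chi y).
Local Notation AM := (monoid_algebra A M).
Implicit Types f g : AM.

(** The universal property of [A[M]]. The two laws of [chi] are arguments so that the instances
    below make every such map a ring morphism. *)
Definition ma_lift of chi 1%g = 1 &
    (forall x y, chi (x * y)%g = chi x * chi y) :=
  fun f : AM => \sum_(x <- msupp f) iota f@_x * chi x.

Local Notation L := (ma_lift chi1 chiM).

Lemma ma_liftEw (d : {fset M}) f : (msupp f `<=` d)%fset ->
  L f = \sum_(x <- d) iota f@_x * chi x.
Proof.
move=> le_fd; apply: big_fset_incl => // x _ /mcoeff_outdom->.
by rewrite rmorph0 mul0r.
Qed.

Lemma ma_liftB : {morph L : f g / f - g}.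
Proof.
move=> f g; rewrite (ma_liftEw (msuppB_le f g)).
rewrite (ma_liftEw (fsubsetUl (msupp f) (msupp g))).
rewrite (ma_liftEw (fsubsetUr (msupp f) (msupp g))) -sumrB.
by apply: eq_bigr => x _; rewrite mcoeffB rmorphB mulrBl.
Qed.

HB.instance Definition _ := GRing.isZmodMorphism.Build AM S L ma_liftB.

Lemma ma_liftU a x : L << a *g x >> = iota a * chi x.
Proof. by rewrite (ma_liftEw msuppU_le) big_seq_fset1 mcoeffUU. Qed.

Lemma ma_liftM : {morph L : f g / f * g}.
Proof.
move=> f g; rewrite [f * g]/(ma_mul f g) /ma_mul raddf_sum mulr_suml.
apply: eq_bigr => x _; rewrite raddf_sum mulr_sumr; apply: eq_bigr => y _.
by rewrite /= ma_liftU rmorphM chiM mulrACA.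
Qed.

Lemma ma_lift1 : L 1 = 1.
Proof. by rewrite [1]/(ma_one A M) /ma_one ma_liftU rmorph1 mul1r. Qed.

HB.instance Definition _ :=
  GRing.isMonoidMorphism.Build AM S L (conj ma_lift1 ma_liftM).

End Lift.

Section Monomials.
Context (A : comNzRingType) (M : comMonoidType).
Local Notation AM := (monoid_algebra A M).
Implicit Types (a : A) (x : M).

Definition ma_aug : AM -> A :=
  ma_lift (chi := fun _ : M => 1) idfun erefl (fun _ _ => esym (mulr1 1)).

HB.instance Definition _ := GRing.RMorphism.on ma_aug.

Lemma ma_augU a x : ma_aug << a *g x >> = a.
Proof. by rewrite /ma_aug ma_liftU mulr1. Qed.

Lemma monoid_algebraXU x n : (<< x >> : AM) ^+ n = << (x ^+ n)%g >>.
Proof.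
elim: n => [|n IHn]; first by rewrite expr0 expg0.
by rewrite exprS IHn monoid_algebraMU mulr1 -expgS.
Qed.

Definition ma_const a : AM := << a *g 1%g >>.

Lemma ma_constB : {morph ma_const : a b / a - b}.
Proof. exact: monalgUB. Qed.

Lemma ma_constM : {morph ma_const : a b / a * b}.
Proof. by move=> a b; rewrite /ma_const monoid_algebraMU mulg1. Qed.

HB.instance Definition _ := GRing.isZmodMorphism.Build A AM ma_const ma_constB.
HB.instance Definition _ :=
  GRing.isMonoidMorphism.Build A AM ma_const (conj erefl ma_constM).

Lemma ma_constMU a b x : ma_const a * << b *g x >> = << a * b *g x >>.
Proof. by rewrite monoid_algebraMU mul1g. Qed.

Lemma ma_augK a : ma_aug (ma_const a) = a.
Proof. exact: ma_augU. Qed.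

End Monomials.

(** * The quotient of [M] that identifies elements with a common positive power *)

Section RootQuotient.
Local Open Scope quotient_scope.
Local Open Scope group_scope.
Context (M : comMonoidType).
Implicit Types x y z : M.

Definition root_eqv x y : Prop := exists n, (0 < n)%N /\ x ^+ n = y ^+ n.

Lemma root_eqv_mul x x' y y' :
  root_eqv x x' -> root_eqv y y' -> root_eqv (x * y) (x' * y').
Proof.
move=> [n [n_gt0 xn]] [m [m_gt0 ym]]; exists (n * m)%N.
by rewrite muln_gt0 n_gt0 !expgM_com !expgnA xn (expgnAC y) ym (expgnAC y').
Qed.

Definition root_rel : rel M := fun x y => `[< root_eqv x y >].

Lemma root_rel_equiv : equiv_class_of root_rel.
Proof.
split=> [x|x y|y x z].
- by apply/asboolP; exists 1%N.
- by apply/asboolP/asboolP => -[n [n_gt0 xyn]]; exists n.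
- move=> /asboolP[n [n_gt0 xyn]] /asboolP[m [m_gt0 yzm]].
  apply/asboolP; exists (n * m)%N.
  by rewrite muln_gt0 n_gt0 expgnA xyn expgnAC yzm -expgnA mulnC.
Qed.

Canonical root_equiv : equiv_rel M := EquivRelPack root_rel_equiv.

Definition root_quot : Type := {eq_quot root_equiv}.

HB.instance Definition _ := Choice.on root_quot.
HB.instance Definition _ := EqQuotient.on root_quot.

Lemma root_quotP x y : \pi_root_quot x = \pi_root_quot y <-> root_eqv x y.
Proof.
split=> [/eqP|exy]; first by rewrite piE => /asboolP.
by apply/eqP; rewrite piE; apply/asboolP.
Qed.

Definition root_quot_mul (a b : root_quot) : root_quot :=
  \pi_root_quot (repr a * repr b).

Lemma root_quot_mulE x y :
  root_quot_mul (\pi_root_quot x) (\pi_root_quot y) = \pi_root_quot (x * y).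
Proof. by apply/root_quotP/root_eqv_mul; apply/root_quotP; apply: reprK. Qed.

Lemma root_quot_mulA : associative root_quot_mul.
Proof.
elim/quotW=> x; elim/quotW=> y; elim/quotW=> z.
by rewrite (root_quot_mulE y) (root_quot_mulE x y) !root_quot_mulE mulgA.
Qed.

Lemma root_quot_mul1 : left_id (\pi_root_quot 1) root_quot_mul.
Proof. by elim/quotW=> x; rewrite root_quot_mulE mul1g. Qed.

Lemma root_quot_mulC : commutative root_quot_mul.
Proof. by elim/quotW=> x; elim/quotW=> y; rewrite !root_quot_mulE mulmonC. Qed.

Lemma root_quot_mulr1 : right_id (\pi_root_quot 1) root_quot_mul.
Proof. by move=> a; rewrite root_quot_mulC root_quot_mul1. Qed.

HB.instance Definition _ :=
  isMonoid.Build root_quot root_quot_mulA root_quot_mul1 root_quot_mulr1.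
HB.instance Definition _ := Monoid_isCommutative.Build root_quot root_quot_mulC.

Lemma root_quotM x y :
  \pi_root_quot (x * y) = \pi_root_quot x * \pi_root_quot y.
Proof. exact/esym/root_quot_mulE. Qed.

Lemma root_quotX x n :
  \pi_root_quot (x ^+ n) = \pi_root_quot x ^+ n :> root_quot.
Proof. by elim: n => // n IHn; rewrite !expgS root_quotM IHn. Qed.

Lemma root_quot_eq1 x : \pi_root_quot x = 1 <-> torsion x.
Proof.
split=> [/root_quotP|] [n [n_gt0 xn1]]; first by exists n; rewrite xn1 expg1n.
by apply/root_quotP; exists n; rewrite expg1n.
Qed.

Lemma root_quot_cancellative : cancellative M -> cancellative root_quot.
Proof.
move=> canM; elim/quotW=> x; elim/quotW=> y; elim/quotW=> z.
rewrite -!root_quotM => /root_quotP[n [n_gt0]].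
by rewrite !expgM_com => /canM xyn; apply/root_quotP; exists n.
Qed.

Lemma root_quot_power_cancellative : power_cancellative root_quot.
Proof.
elim/quotW=> x; elim/quotW=> y n n_gt0; rewrite -!root_quotX.
move=> /root_quotP[m [m_gt0 xyn]]; rewrite -!expgnA in xyn.
by apply/root_quotP; exists (n * m)%N; rewrite muln_gt0 n_gt0.
Qed.

(** If [x * y] is trivial in the quotient, a positive power of it is [1] in [M]. So [x] is a unit,
    hence torsion, hence trivial in the quotient. *)
Lemma root_quot_positive :
  (forall x, monoid_unit x -> torsion x) -> positive root_quot.
Proof.
move=> unit_tors; elim/quotW=> x [y]; elim/quotW: y => y.
rewrite -root_quotM => /root_quot_eq1[[|n] [n_gt0 xyn1]] //.
apply/root_quot_eq1/unit_tors; exists (y * (x * y) ^+ n).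
by rewrite mulgA -expgS.
Qed.

End RootQuotient.

(** * The grading of [A[M]] by this quotient *)

Section Grading.
Context (A : comNzRingType) (M : comMonoidType).
Local Notation AM := (monoid_algebra A M).
Local Notation D := (root_quot M).
Local Notation pi := (\pi_D)%qT.
Local Notation AMD := (monoid_algebra AM D).

Lemma grading_chi1 : << << 1%g >> : AM *g pi 1%g >> = 1 :> AMD.
Proof. by []. Qed.

Lemma grading_chiM x y : << << (x * y)%g >> : AM *g pi (x * y)%g >> =
  (<< << x >> : AM *g pi x >> : AMD) * << << y >> : AM *g pi y >>.
Proof. by rewrite monoid_algebraMU monoid_algebraMU mulr1 root_quotM. Qed.

(** The coefficient of [grading u] at [d] is the component of [u] of degree [d], kept inside [A[M]].
    So the results on units apply with [A[M]] as the ring of coefficients. *)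
Definition grading : AM -> AMD :=
  ma_lift (@ma_const AM D \o @ma_const A M) grading_chi1 grading_chiM.

HB.instance Definition _ := GRing.RMorphism.on grading.

Lemma gradingU (a : A) (x : M) :
  grading << a *g x >> = << << a *g x >> : AM *g pi x >>.
Proof.
by rewrite /grading ma_liftU /= ma_constMU ma_constMU mulr1.
Qed.

Lemma grading_augK (u : AM) : ma_aug (grading u) = u.
Proof.
rewrite {1}[u]monalgE (raddf_sum grading) raddf_sum [RHS]monalgE.
apply: eq_bigr => x _.
by rewrite /= gradingU ma_augU.
Qed.

Lemma mcoeff_grading1 (u : AM) : (grading u)@_1%g =
  \sum_(x <- msupp u | `[< torsion x >]) (ma_const M u@_x * << x >>).
Proof.
rewrite {1}[u]monalgE (raddf_sum grading) raddf_sum [RHS]big_mkcond.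
apply: eq_bigr => x _.
rewrite /= gradingU mcoeffU ma_constMU mulr1.
case: asboolP => [/root_quot_eq1->|tx].
  by rewrite eqxx.
by case: eqP => [/root_quot_eq1|].
Qed.

(** [grading u] is a unit, so its coefficients outside degree [1] are nilpotent, and the
    augmentation adds all components up to [u]. *)
Lemma unit_torsion_part (u : AM) :
    cancellative M -> (forall x : M, monoid_unit x -> torsion x) ->
    ring_unit u ->
  ring_nilpotent 
    (u - \sum_(x <- msupp u | `[< torsion x >]) (ma_const M u@_x * << x >>)).
Proof.
move=> canM unit_tors unit_u; rewrite -mcoeff_grading1 -{1}[u]grading_augK.
have unit_gu : ring_unit (grading u) by apply: ring_unit_rmorph.
set g := grading u in unit_gu *.
have nil_g d : d <> 1%g -> ring_nilpotent g@_d.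
  apply: unit_mcoeff_nilpotent => //.
  - exact: root_quot_cancellative.
  - exact: root_quot_power_cancellative.
  - exact: root_quot_positive.
(* Adjoining [1] to the support lets the term of degree [1] be split off even when it vanishes. *)
rewrite [ma_aug g](ma_liftEw _ _ _ (fsubsetUl (msupp g) [fset 1%g]%fset)) /=.
rewrite (big_fsetD1 1%g) /= ?inE ?eqxx ?orbT // mulr1 addrAC subrr add0r.
apply: ring_nilpotent_sum => d; rewrite !inE => /andP[/eqP d_neq1 _] _.
by rewrite mulr1; apply: nil_g.
Qed.

End Grading.

(** * Unit-additivity passed between [A] and [A[M]], and nilpotent [x - 1] *)

Section MonoidAlgebraUnitAdditive.
Context (A : comNzRingType) (M : comMonoidType).
Local Notation AM := (monoid_algebra A M).
Implicit Types (x : M) (u v : AM).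

Lemma unit_constant u :
    cancellative M -> (forall x, monoid_unit x -> torsion x) ->
    (forall x, torsion x -> ring_nilpotent ((<< x >> : AM) - 1)) ->
    ring_unit u ->
  exists2 a, ring_unit a & ring_nilpotent (u - ma_const M a).
Proof.
move=> canM unit_tors nil_tors unit_u.
(* Any such [a] is a unit: it differs by a nilpotent from the augmentation of [u], which is a
   unit. *)
suff [a nil_ua] : exists a, ring_nilpotent (u - ma_const M a).
  exists a => //; have unit_aug : ring_unit (ma_aug u).
    exact: ring_unit_rmorph.
  have: ring_nilpotent (ma_aug (u - ma_const M a)).
    exact: ring_nilpotent_rmorph.
  rewrite rmorphB /= ma_augK; move=> /ring_nilpotentN nil_aug.
  by have := ring_unitD_nil unit_aug nil_aug; rewrite opprB addrC subrK.
exists (\sum_(x <- msupp u | `[< torsion x >]) u@_x).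
have := unit_torsion_part canM unit_tors unit_u.
set t := \sum_(x <- _ | _) _ => nil_ut.
rewrite -[X in ring_nilpotent (X - _)](subrK t) -addrA.
apply: ring_nilpotentD => //.
rewrite /t rmorph_sum -sumrB; apply: ring_nilpotent_sum => x _ /asboolP tx.
rewrite -[X in _ - X]mulr1 -mulrBr mulrC.
exact/ring_nilpotentM/nil_tors.
Qed.

Lemma unit_additive_monoid_algebra :
    cancellative M -> (forall x, monoid_unit x -> torsion x) ->
    (forall x, torsion x -> ring_nilpotent ((<< x >> : AM) - 1)) ->
  unit_additive A -> unit_additive AM.
Proof.
move=> canM unit_tors nil_tors uaA u v.
move=> /(unit_constant canM unit_tors nil_tors)[a unit_a nil_ua].
move=> /(unit_constant canM unit_tors nil_tors)[b unit_b nil_vb].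
have nil_uv := ring_nilpotentD nil_ua nil_vb.
have -> : u + v = ma_const M (a + b) + (u - ma_const M a + (v - ma_const M b)).
  by rewrite rmorphD [RHS]addrC addrACA !subrK.
have [unit_ab|nil_ab] := uaA a b unit_a unit_b; [left | right].
  by apply: ring_unitD_nil => //; apply: ring_unit_rmorph.
by apply: ring_nilpotentD => //; apply: ring_nilpotent_rmorph.
Qed.

Lemma unit_additive_coeff : unit_additive AM -> unit_additive A.
Proof.
move=> uaAM a b unit_a unit_b.
have := uaAM (ma_const M a) (ma_const M b) (ring_unit_rmorph _ unit_a)
  (ring_unit_rmorph _ unit_b).
rewrite -rmorphD => -[unit_ab|nil_ab]; [left | right].
  by have := ring_unit_rmorph (@ma_aug A M) unit_ab; rewrite /= ma_augK.
by have := ring_nilpotent_rmorph (@ma_aug A M) nil_ab; rewrite /= ma_augK.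
Qed.

Lemma unit_monomial_nilpotent x :
  unit_additive AM -> monoid_unit x -> ring_nilpotent ((<< x >> : AM) - 1).
Proof.
move=> uaAM [y xy1]; have unit_x : ring_unit (<< x >> : AM).
  by exists << y >>; rewrite monoid_algebraMU xy1 mulr1.
have unitN1 : ring_unit (-1 : AM) by exists (-1); rewrite mulrNN mulr1.
have [unit_x1|//] := uaAM _ _ unit_x unitN1.
have : ring_unit (ma_aug ((<< x >> : AM) - 1)) by apply: ring_unit_rmorph.
by rewrite rmorphB rmorph1 /= ma_augU subrr => /ring_unit_neq0.
Qed.

(* If [x] is not torsion, the coefficient of [(x - 1)^N] at [1] is [(-1)^N]. *)
Lemma nilpotent_torsion x : ring_nilpotent ((<< x >> : AM) - 1) -> torsion x.
Proof.
move=> [N nilN]; apply: contrapT => ntx.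
have: (((<< x >> : AM) - 1) ^+ N)@_1%g = (-1) ^+ N.
  rewrite addrC exprDn raddf_sum big_ord_recl /= big1 => [|i _].
    rewrite addr0 subn0 expr0 mulr1 bin0 mulr1n -(signr_odd AM) -(signr_odd A).
    by case: odd; rewrite ?expr1 ?mcoeffN mcoeff_one eqxx.
  rewrite mcoeffMn monoid_algebraXU -signr_odd mulr_sign.
  rewrite (fun_if (fun f => f@_1%g)).
  rewrite mcoeffN mcoeffU; case: eqP => [xi1|_]; last first.
    by rewrite oppr0 if_same mul0rn.
  by case: ntx; exists (lift ord0 i).
by rewrite nilN mcoeff0 => /esym/eqP; rewrite signr_eq0.
Qed.

(** [x ^+ d - 1] is [x - 1] times a sum of [d] powers of [x]. Each power is [1] up to a nilpotent,
    so the sum is [d] up to a nilpotent, hence a unit, and [x - 1] vanishes. *)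
Lemma nilpotent_exp_eq1 x d : ring_nilpotent ((<< x >> : AM) - 1) ->
  ring_unit (d%:R : A) -> (x ^+ d)%g = 1%g -> x = 1%g.
Proof.
move=> nil_x unit_d xd1.
have : ring_unit (\sum_(i < d) (<< x >> : AM) ^+ i).
  have -> : \sum_(i < d) (<< x >> : AM) ^+ i =
      d%:R + \sum_(i < d) ((<< x >> : AM) ^+ i - 1).
    by rewrite sumrB sumr_const card_ord addrC subrK.
  apply: ring_unitD_nil; last first.
    by apply: ring_nilpotent_sum => i _ _; apply: ring_nilpotent_subX.
  rewrite -(rmorph_nat (@ma_const A M)).
  exact: ring_unit_rmorph.
move=> [w w1]; have: (<< x >> : AM) - 1 = 0.
  rewrite -[LHS]mulr1 -[X in _ * X]w1 mulrA -subrX1 monoid_algebraXU xd1.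
  by rewrite [X in _ - X]/(1 : AM) subrr mul0r.
move=> /(congr1 (fun f : AM => f@_x)).
rewrite mcoeffB mcoeffU mcoeff_one eqxx mcoeff0; case: eqP => // _ /eqP.
by rewrite subr0 oner_eq0.
Qed.

End MonoidAlgebraUnitAdditive.

(** * Torsion of prime power order, and both directions of the equivalence *)

(** Modulo [p], the elements [(x - 1) ^+ p] and [x ^+ p - 1] agree. *)
Lemma nilpotent_frobenius (R : comPzRingType) p (x : R) : prime p ->
  ring_nilpotent (p%:R : R) -> ring_nilpotent (x ^+ p - 1) ->
  ring_nilpotent (x - 1).
Proof.
move=> p_pr nil_p nil_xp; apply: (@ring_nilpotent_exp _ _ p).
suff [w ->] : exists w, (x - 1) ^+ p = (x ^+ p - 1) - p%:R * w.
  by apply: ring_nilpotentD => //; apply/ring_nilpotentN/ring_nilpotentM.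
(* Expanding [(y + 1) ^+ p] instead of [(x - 1) ^+ p] avoids signs. *)
set y := x - 1; have -> : x = y + 1 by rewrite subrK.
case: p p_pr {nil_p nil_xp} => // p p_pr.
(* The prime is now [p.+1]; the witness collects the middle binomial terms divided by it. *)
exists (\sum_(i < p) y ^+ i.+1 *+ ('C(p.+1, i.+1) %/ p.+1)).
set w := \sum_(i < p) _.
suff -> : (y + 1) ^+ p.+1 = y ^+ p.+1 + p.+1%:R * w + 1.
  by rewrite !addrK.
rewrite addrC exprDn big_ord_recl big_ord_recr /= bin0 binn !expr0 !expr1n.
rewrite !mulr1n !mul1r mulr_sumr [LHS]addrC [Y in Y + 1 = _]addrC.
congr (_ + _ + _).
apply: eq_bigr => i _; rewrite expr1n mul1r mulr_natl -mulrnA divnK //.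
by apply: prime_dvd_bin; rewrite //= ltnS ltn_ord.
Qed.

Lemma nilpotent_frobenius_iter (R : comPzRingType) p n (x : R) : prime p ->
  ring_nilpotent (p%:R : R) -> x ^+ (p ^ n) = 1 -> ring_nilpotent (x - 1).
Proof.
move=> p_pr nil_p; elim: n x => [|n IHn] x.
  by rewrite expr1 => ->; rewrite subrr; apply: ring_nilpotent0.
by rewrite expnS exprM => /IHn; apply: nilpotent_frobenius.
Qed.

Lemma quot_tors_eq1 (M : comMonoidType) p (p_pr : prime p) (x : M) :
  (\pi_(quot_tors M p_pr) x)%qT = 1%g <-> tors_part p x.
Proof.
split=> [/quot_torsP/(tors_coset_eqP p_pr)[t tp ->]|tp]; first by rewrite mul1g.
apply/quot_torsP/funext => y; apply/propext; split=> -[s sp ->].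
  by exists (x * s)%g; rewrite ?mul1g //; apply: tors_partM.
case/(tors_partP _ p_pr): tp => n xpn1.
(* The power of [x] is its inverse. *)
exists (x ^+ (p ^ n).-1 * s)%g.
  apply: tors_partM => //; apply/(tors_partP _ p_pr); exists n.
  by rewrite expgnAC xpn1 expg1n.
by rewrite mulgA -expgS prednK ?expn_gt0 ?prime_gt0 // xpn1.
Qed.

Theorem theorem3p6 (A : comNzRingType) (M : comMonoidType)
    (M_cancel : cancellative M) :
  unit_additive (monoid_algebra A M) <->
  [/\ ringchar A = 0%N, unit_additive A, torsion_free M & positive M] \/
  (exists (p : nat) (p_pr : prime p),
     [/\ exists2 e : nat, (0 < e)%N & ringchar A = (p ^ e)%N,
         unit_additive A,
         torsion_free (quot_tors M p_pr) &
         positive (quot_tors M p_pr)]).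
Proof.
have unit_torsion (N : comMonoidType) (x : N) : torsion x -> monoid_unit x.
  by move=> [[|n] [n_gt0 xn1]] //; exists (x ^+ n)%g; rewrite -expgS.
split=> [uaAM|[[char0 uaA tfM posM]|[p [p_pr [[e e_gt0 charE] uaA tfQ posQ]]]]].
- have uaA := unit_additive_coeff uaAM.
  have [char0|[p [p_pr [e e_gt0 charE]]]] := unit_additive_char uaA.
    (* Torsion elements are units, so positivity gives torsion-freeness. *)
    left; suff posM : positive M by split=> // x /unit_torsion/posM.
    move=> x /(unit_monomial_nilpotent uaAM) nil_x.
    have [n [n_gt0 xn1]] := nilpotent_torsion nil_x.
    apply: nilpotent_exp_eq1 nil_x _ xn1.
    (* No positive integer is nilpotent in characteristic [0], so unit-additivity makes them units,
       in particular [n]. *)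
    suff: forall k, (0 < k <= n)%N -> ring_unit (k%:R : A).
      by apply; rewrite n_gt0 /=.
    apply: unit_additive_natr => // k /andP[k_gt0 _] [m /eqP].
    by rewrite -natrX ringcharP char0 dvd0n expn_eq0 gtn_eqF.
  right; exists p, p_pr.
  suff posQ : positive (quot_tors M p_pr).
    by split=> //; [exists e | move=> x /unit_torsion/posQ].
  elim/quotW=> x [y]; elim/quotW: y => y.
  rewrite quot_torsM => /quot_tors_eq1/(tors_partP _ p_pr)[k xy1].
  apply/quot_tors_eq1; have unit_x : monoid_unit x.
    exists (y * (x * y) ^+ (p ^ k).-1)%g.
    by rewrite mulgA -expgS prednK ?expn_gt0 ?prime_gt0.
  have nil_x := unit_monomial_nilpotent uaAM unit_x.
  have [n [n_gt0 xn1]] := nilpotent_torsion nil_x.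
  (* Split off the [p]-part of [n]: the cofactor [d] is a unit in [A], and the power of [x] with
     exponent [p ^ logn p n] has [d]-th power [1], so it is [1] itself. *)
  have [d co_pd nE] := pfactor_coprime p_pr n_gt0.
  apply/(tors_partP _ p_pr); exists (logn p n).
  apply: (@nilpotent_exp_eq1 A _ _ d).
  - by rewrite -monoid_algebraXU; apply: ring_nilpotent_subX.
  - by apply: coprime_ring_unit; rewrite charE coprimeXl.
  - by rewrite -expgnA mulnC -nE.
- apply: unit_additive_monoid_algebra => // x.
    by move=> /posM ->; exists 1%N; rewrite expg1.
  by move=> /tfM->; exists 1%N; rewrite expr1 subrr.
(* A unit of [M] stays a unit in the quotient, so its coset is trivial by positivity. *)
- have tors_unit (x : M) : monoid_unit x -> tors_part p x.
    move=> [y xy1]; apply/(quot_tors_eq1 p_pr)/posQ.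
    by exists (\pi y)%qT; rewrite quot_torsM xy1.
  apply: unit_additive_monoid_algebra => // x.
    move=> /tors_unit[n [n_gt0 xn1 _]]; by exists (p ^ n)%N.
  move=> /unit_torsion/tors_unit/(tors_partP _ p_pr)[n xpn1].
  apply: (@nilpotent_frobenius_iter _ p n) => //; last first.
    by rewrite monoid_algebraXU xpn1.
  exists e; rewrite -natrX -(rmorph_nat (@ma_const A M)).
  rewrite -charE; have /eqP -> : (ringchar A)%:R == 0 :> A.
    by rewrite ringcharP dvdnn.
  by rewrite rmorph0.
Qed.
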